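(* Let $(E,\langle\cdot,\cdot\rangle)$ be a Hilbert space with norm $\|\cdot\|$, let $X$ be a Radon random vector on a probability space with values in $E$ and distribution $P$, let $r\in(0,+\infty)$ with $\int_E\|x\|^r\,dP(x)<+\infty$, let $n\ge1$, and assume that $K=\operatorname{supp}(P)$ is convex. If the $L^r$-distortion function $G_{r,n}^P$ has a strict local minimum at $a=(a_1,\ldots,a_n)\in E^n$, then $a_i\in K$ for every $i\in\{1,\ldots,n\}$. In particular, the following conclusions hold (whenever each $a_i$ is a non-isolated point of $K$): the components $a_1,\ldots,a_n$ are pairwise distinct; if $r\ge1$, then with $\Gamma=\{a_1,\ldots,a_n\}$, for every $i$ and every Borel set $C$ with $W_{a_i}(\Gamma)\subset C\subset V_{a_i}(\Gamma)$ one has $a_i\in\operatorname{argmin}_{y\in E}G_{r,1}^{P(\cdot\mid C)}(y)$; and if $r\ge1$ and (when $r=1$) $P(\{a_i\})=0$ for every $i$, then $\Gamma$ is an $L^r$-stationary $n$-quantizer for $P$ and $\Gamma$ is admissible for $P$. Moreover, if $r\ge2$, $P(\{a_i\})=0$ for every $i\in\{1,\ldots,n\}$ when $r>2$, and $K$ has nonempty interior, then $a_i$ is an interior point of $K$ for every $i$.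
   Context: $\operatorname{supp}(P)$ denotes the support of $P$. For a nonempty finite $\Gamma\subset E$, $d(x,\Gamma)=\min_{b\in\Gamma}\|x-b\|$. For a Borel probability $Q$ on $E$, $G_{r,n}^Q:E^n\to\mathbb R_+$, $G_{r,n}^Q(a_1,\ldots,a_n)=\int_E\min_{1\le i\le n}\|x-a_i\|^r\,dQ(x)$. A strict local minimum at $a$ means there is a neighbourhood $U$ of $a$ in $E^n$ with $G_{r,n}^P(b)>G_{r,n}^P(a)$ for all $b\in U\setminus\{a\}$. For a Borel $C$ with $P(C)>0$, $P(\cdot\mid C)=P(\cdot\cap C)/P(C)$. For finite $\Gamma\subset E$ and $b\in\Gamma$: $V_b(\Gamma)=\{x:\|x-b\|=d(x,\Gamma)\}$, $W_b(\Gamma)=\{x:\|x-b\|<d(x,\Gamma\setminus\{b\})\}$. A Voronoi partition induced by $\Gamma$ is a Borel partition $\{C_b(\Gamma):b\in\Gamma\}$ of $E$ with $C_b(\Gamma)\subset V_b(\Gamma)$. $\Gamma$ is admissible for $P$ if $P\big(\bigcup_{b\in\Gamma}W_b(\Gamma)\big)=1$. For $x\neq0$, $\nabla\|\cdot\|(x)=\langle x,\cdot\rangle/\|x\|\in E^*$ is the Gâteaux derivative of the norm. For $r\ge1$, a set $\Gamma$ with $\operatorname{card}(\Gamma)=n$ (and $P(\Gamma)=0$ if $r=1$) is an $L^r$-stationary $n$-quantizer for $P$ if there is a Voronoi partition $\{C_b(\Gamma)\}$ induced by $\Gamma$ with, for every $b\in\Gamma$, $P(C_b(\Gamma))>0$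 and $\mathbb E\big[\mathbf 1_{C_b(\Gamma)\setminus\{b\}}(X)\|X-b\|^{r-1}\nabla\|\cdot\|(b-X)\big]=0$ in $E^*$ (Gelfand integral). *)

(* Defs.v *)
From HB Require Import structures.
From mathcomp Require Import all_boot all_order all_algebra.
From mathcomp Require Import all_classical all_reals all_analysis.
Set Implicit Arguments.
Unset Strict Implicit.
Unset Printing Implicit Defensive.
Import Order.TTheory GRing.Theory Num.Theory.
Local Open Scope classical_set_scope.
Local Open Scope ring_scope.

Definition borelE (R : realType) (E : normedModType R) :=
  g_sigma_algebraType (@open E).

(* ip is an inner product on E inducing the norm of E
   (so (E, ip) is a Hilbert space when E is complete). *)
Definition is_hilbert_inner (R : realType) (E : normedModType R)
    (ip : E -> E -> R) :=
  [/\ (forall x y, ip x y = ip y x),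
      (forall (l : R) (x y z : E), ip (l *: x + y) z = l * ip x z + ip y z) &
      (forall x, `|x| ^+ 2 = ip x x)].

Definition radon (R : realType) (E : normedModType R)
    (P : set (borelE E) -> \bar R) :=
  forall A : set (borelE E), measurable A ->
    P A = ereal_sup [set P K | K in [set K : set (borelE E) |
                                      @compact E K /\ K `<=` A]].

(* Support of P : the points all of whose open neighbourhoods have positive
   mass (= the smallest closed set of full measure). *)
Definition supp (R : realType) (E : normedModType R)
    (P : set (borelE E) -> \bar R) : set E :=
  [set x | forall U : set E, open U -> U x -> (0 < P U)%E].

Definition distortion (R : realType) (E : normedModType R)
    (Q : set (borelE E) -> \bar R) (r : R) (n : nat) (a : 'I_n -> E) : \bar R :=
  (\int[Q]_x
     \big[Order.min/+oo%E]_(i < n) ((`|(x : E) - a i| `^ r)%:E))%E.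

Definition strict_local_min (R : realType) (E : normedModType R) (n : nat)
    (G : ('I_n -> E) -> \bar R) (a : 'I_n -> E) :=
  exists2 e : R, 0 < e &
    forall b : 'I_n -> E, (forall i, `|b i - a i| < e) -> b <> a -> (G a < G b)%E.

Definition condP (R : realType) (E : normedModType R)
    (P : set (borelE E) -> \bar R) (C : set (borelE E)) :
    set (borelE E) -> \bar R :=
  fun A => (((fine (P C))^-1)%:E * P (A `&` C))%E.

(* Voronoi cells of Gamma = {a_1,...,a_n} at b = a_i:
   V_{a_i} = {x : |x - a_i| = d(x, Gamma)},
   W_{a_i} = {x : |x - a_i| < d(x, Gamma \ {a_i})}  (d(x, empty) = +oo). *)
Definition voronoiV (R : realType) (E : normedModType R) (n : nat)
    (a : 'I_n -> E) (i : 'I_n) : set E :=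
  [set x | forall j, `|x - a i| <= `|x - a j|].

Definition voronoiW (R : realType) (E : normedModType R) (n : nat)
    (a : 'I_n -> E) (i : 'I_n) : set E :=
  [set x | forall j, a j <> a i -> `|x - a i| < `|x - a j|].

(* Voronoi partition induced by Gamma = {a_i} (a injective, cells indexed by i) *)
Definition voronoi_partition (R : realType) (E : normedModType R) (n : nat)
    (a : 'I_n -> E) (C : 'I_n -> set (borelE E)) :=
  [/\ (forall i, measurable (C i)),
      (forall i j, i != j -> C i `&` C j = set0),
      (\bigcup_(i in [set: 'I_n]) C i = [set: borelE E]) &
      (forall i, C i `<=` voronoiV a i)].

(* Gamma = {a_1,..,a_n} is an L^r-stationary n-quantizer for P:
   card Gamma = n (a injective), P(Gamma) = 0 if r = 1, and there is a Voronoi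
   partition with P(C_b) > 0 and
   E[1_{C_b \ {b}}(X) |X-b|^{r-1} grad|.|(b - X)] = 0 in E^* (Gelfand integral:
   tested against every u in E, grad|.|(z)(u) = <z,u>/|z|). *)
Definition stationary_quantizer (R : realType) (E : normedModType R)
    (ip : E -> E -> R) (P : set (borelE E) -> \bar R) (r : R) (n : nat)
    (a : 'I_n -> E) :=
  [/\ injective a,
      (r = 1 -> P (range a) = 0%E) &
      exists C : 'I_n -> set (borelE E), voronoi_partition a C /\
        forall i, (0 < P (C i))%E /\
          forall u : E,
            let f := fun x : borelE E =>
              ((`|(x : E) - a i| `^ (r - 1)) * (ip (a i - x) u / `|a i - x|))%:E in
            P.-integrable (C i `\ a i) f /\
            (\int[P]_(x in C i `\ a i) f x = 0)%E].

Definition admissible (R : realType) (E : normedModType R)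
    (P : set (borelE E) -> \bar R) (n : nat) (a : 'I_n -> E) :=
  P (\bigcup_(i in [set: 'I_n]) voronoiW a i) = 1%E.

(* Main.v *)
Require Import Defs.
From HB Require Import structures.
From mathcomp Require Import all_boot all_order all_algebra.
From mathcomp Require Import all_classical all_reals all_analysis.
From mathcomp Require Import measurable_realfun ring lra.
Set Implicit Arguments.
Unset Strict Implicit.
Unset Printing Implicit Defensive.
Import Order.TTheory GRing.Theory Num.Theory.
Import numFieldNormedType.Exports.
Local Open Scope classical_set_scope.
Local Open Scope ring_scope.

(** Moving a center towards its metric projection on the closed convex set
    K = supp P brings it closer to every point of K, hence does not increase the
    distortion: at a strict local minimum all centers lie in K, and they are
    distinct because a repeated center could be moved freely.
    Off any Borel cell C between W_i and V_i the center a_i can be replaced by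
    another one, so a_i locally minimizes y |-> int_C |x - y|^r dP; this function
    is convex for r >= 1, so a_i minimizes it globally, and differentiating under
    the integral gives stationarity for every such C.  Comparing the cells W_i
    and W_i u (V_i n V_j), for i and for j, the weighted integral of a_i - a_j
    over V_i n V_j vanishes, hence P(V_i n V_j) = 0.
    If a_i were a boundary point of K, stationarity tested against an almost
    normal direction of K at a_i would be violated, since P charges a ball in
    the interior of K n W_i and |x - a_i|^(r-2) is integrable for r >= 2. *)

(** * Inner products and projections *)

Section hilbert_space.
Context (R : realType) (E : normedModType R) (ip : E -> E -> R).
Hypothesis hip : is_hilbert_inner ip.

Lemma ipC x y : ip x y = ip y x. Proof. by case: hip. Qed.

Lemma ipxx x : ip x x = `|x| ^+ 2. Proof. by case: hip. Qed.

Lemma ipDl x y z : ip (x + y) z = ip x z + ip y z.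
Proof. by case: hip => _ /(_ 1 x y z) + _; rewrite scale1r mul1r. Qed.

Lemma ip0l z : ip 0 z = 0.
Proof.
have := ipDl 0 0 z; rewrite addr0 => h.
by apply: (@addrI _ (ip 0 z)); rewrite addr0 -h.
Qed.

Lemma ipZl (t : R) x z : ip (t *: x) z = t * ip x z.
Proof. by case: hip => _ /(_ t x 0 z) + _; rewrite addr0 ip0l addr0. Qed.

Lemma ipNl x z : ip (- x) z = - ip x z.
Proof. by rewrite -scaleN1r ipZl mulN1r. Qed.

Lemma ipBl x y z : ip (x - y) z = ip x z - ip y z.
Proof. by rewrite ipDl ipNl. Qed.

Lemma ipBr x y z : ip x (y - z) = ip x y - ip x z.
Proof. by rewrite ipC ipBl ![ip _ x]ipC. Qed.

Lemma ipNr x y : ip x (- y) = - ip x y.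
Proof. by rewrite ipC ipNl ipC. Qed.

Lemma ipZr (t : R) x y : ip x (t *: y) = t * ip x y.
Proof. by rewrite ipC ipZl ipC. Qed.

Lemma norm_subE x y : `|x - y| ^+ 2 = `|x| ^+ 2 - 2 * ip x y + `|y| ^+ 2.
Proof. rewrite -!ipxx ipBl !ipBr (ipC y x); ring. Qed.

Lemma norm_subZE x (t : R) y :
  `|x - t *: y| ^+ 2 = `|x| ^+ 2 - 2 * t * ip x y + t ^+ 2 * `|y| ^+ 2.
Proof. rewrite norm_subE ipZr -!ipxx ipZl ipZr; ring. Qed.

(** Cauchy-Schwarz, read off from the nonnegativity of the squared norm of |y| x - |x| y. The null
    cases are separated so that one can divide by |x| |y|. *)
Lemma ip_le x y : ip x y <= `|x| * `|y|.
Proof.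
have [->|x0] := eqVneq x 0; first by rewrite ip0l normr0 mul0r.
have [->|y0] := eqVneq y 0; first by rewrite ipC ip0l normr0 mulr0.
have c0 : 0 < `|x| * `|y| by rewrite mulr_gt0// normr_gt0.
have := sqr_ge0 `| `|y| *: x - `|x| *: y|.
rewrite norm_subZE -ipxx ipZl ipC ipZl ipxx ipZl => h.
rewrite -(ler_pM2l c0); nra.
Qed.

Lemma ip_norm_le x y : `|ip x y| <= `|x| * `|y|.
Proof.
rewrite ler_norml ip_le andbT.
by have := ip_le (- x) y; rewrite ipNl normrN; lra.
Qed.

Lemma ip_continuous u : continuous (ip^~ u).
Proof.
move=> x; apply/cvgrPdist_lt => e e0; near=> z.
rewrite -ipBl; apply: (le_lt_trans (ip_norm_le _ _)).
(* The added 1 keeps the divisor positive when [u] is null. *)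
apply: (@le_lt_trans _ _ (`|x - z| * (`|u| + 1))).
  by rewrite ler_wpM2l// lerDl.
rewrite -ltr_pdivlMr; last by rewrite ltr_wpDl.
near: z; apply: (@cvgr_dist_lt _ _ _ _ _ id) => //.
by rewrite divr_gt0// ltr_wpDl.
Unshelve. all: by end_near. Qed.

End hilbert_space.

Section projection.
Context (R : realType) (E : completeNormedModType R) (ip : E -> E -> R).
Hypothesis hip : is_hilbert_inner ip.
Variable K : set E.
Hypotheses (K0 : K !=set0) (clK : closed K).
Hypothesis cvK : forall x y (t : R), 0 <= t <= 1 -> K x -> K y ->
  K (y + t *: (x - y)).

(** Parallelogram law for y - u and y - v: the midpoint of [u] and [v] lies in [K], so its squared
    distance to [y] is at least [c]. Two near-minimizers are therefore close to each other. *)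
Lemma midpoint_dist (y u v : E) (c : R) :
  (forall x, K x -> c <= `|y - x| ^+ 2) -> K u -> K v ->
  `|u - v| ^+ 2 <= 2 * (`|y - u| ^+ 2 - c) + 2 * (`|y - v| ^+ 2 - c).
Proof.
move=> cP Ku Kv.
have hh : 0 <= (1/2 : R) <= 1 by apply/andP; split; lra.
have := cP _ (cvK hh Ku Kv).
have -> : y - (v + (1 / 2) *: (u - v)) = (y - v) - (1/2) *: (u - v).
  by rewrite opprD addrA.
rewrite (norm_subZE hip).
have -> : `|y - u| ^+ 2 = `|(y - v) - 1 *: (u - v)| ^+ 2.
  by rewrite scale1r opprB addrA subrK.
rewrite (norm_subZE hip) => h.
nra.
Qed.

(** The sets of near-minimizers generate a filter, Cauchy by [midpoint_dist]. Its limit exists by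
    completeness, lies in the closed set [K], and attains the infimum by continuity of the norm. *)
Lemma exists_dist_minimizer (y : E) :
  exists2 p, K p & forall x, K x -> `|y - p| ^+ 2 <= `|y - x| ^+ 2.
Proof.
pose S := [set `|y - x| ^+ 2 | x in K].
have S0 : S !=set0 by case: K0 => x Kx; exists (`|y - x| ^+ 2), x.
have lbS : has_lbound S by exists 0 => _ [x _ <-]; exact: sqr_ge0.
have infS : has_inf S by [].
have dle x : K x -> inf S <= `|y - x| ^+ 2.
  by move=> Kx; apply: ge_inf => //; exists x.
pose A (e : R) := [set x | K x /\ `|y - x| ^+ 2 < inf S + e].
have A0 e : 0 < e -> A e !=set0.
  by move=> e0; have [_ [x Kx <-] xe] := inf_adherent e0 infS; exists x.
pose F := filter_from [set e : R | 0 < e] A.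
have FF : ProperFilter F.
  apply: filter_from_proper; last by move=> e; exact: A0.
  apply: filter_from_filter; first by exists 1; exact: ltr01.
  move=> e1 e2 /= e10 e20; exists (Num.min e1 e2) => /=.
    by rewrite lt_min e10.
  move=> x [Kx]; rewrite -ltrBlDl lt_min => /andP[h1 h2].
  by split; split => //; rewrite -ltrBlDl.
have cF : cauchy F.
  apply: cauchy_exP => e e0.
  (* With both excesses over the infimum below e^2/4, [midpoint_dist] gives |u - v|^2 < e^2. *)
  have e40 : 0 < e ^+ 2 / 4 by rewrite divr_gt0// exprn_gt0.
  have [u [Ku uA]] := A0 _ e40.
  exists u; exists (e ^+ 2 / 4) => // v [Kv vA].
  rewrite -ball_normE /=.
  rewrite -(@ltr_pXn2r _ 2)// ?nnegrE// ?(ltW e0)//.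
  have := midpoint_dist dle Ku Kv; lra.
have /cvg_ex[p Fp] : cvg F by exact: cauchy_cvg.
exists p.
  apply: (@closed_cvg _ _ F FF id K clK _ p Fp).
  by exists 1; [exact: ltr01|move=> x []].
move=> x Kx; apply: le_trans (dle _ Kx).
apply/ler_addgt0Pr => e e0.
apply: (@closed_cvg _ _ F FF (fun z => `|y - z| ^+ 2) [set t | t <= inf S + e]).
- exact: closed_le.
- by exists e => // z [_ /ltW].
- apply: (@continuous_cvg _ _ _ F FF id (fun z => `|y - z| ^+ 2)) => //.
  rewrite (_ : (fun z => _) = fun z => `|y - z| * `|y - z|); last first.
    by apply/funext => z; rewrite expr2.
  by apply: cvgM; apply: cvg_norm; apply: cvgB => //; exact: cvg_cst.
Qed.

(** Variational inequality of the projection: were the product c > 0, the point p + t(x - p) of [K]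
    would have squared distance |y - p|^2 - 2tc + t^2 q, smaller than the minimum for small t >
    0. *)
Lemma hilbert_projection (y : E) :
  exists2 p, K p & forall x, K x -> ip (y - p) (x - p) <= 0.
Proof.
have [p Kp pmin] := exists_dist_minimizer y; exists p => // x Kx.
rewrite leNgt; apply/negP => c0.
set c := ip _ _ in c0; pose q := `|x - p| ^+ 2.
have q0 : 0 <= q by exact: sqr_ge0.
have q10 : 0 < q + 1 by rewrite ltr_wpDl.
(* This makes t q < c, so t^2 q cannot compensate 2tc; [q + 1] is a nonzero divisor even if q =
   0. *)
pose t := Num.min 1 (c / (q + 1)).
have t0 : 0 < t by rewrite lt_min ltr01 divr_gt0.
have t1 : t <= 1 by rewrite ge_min lexx.
have tq : t * (q + 1) <= c by rewrite -ler_pdivlMr// ge_min lexx orbT.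
have t01 : 0 <= t <= 1 by rewrite (ltW t0) t1.
have := pmin _ (cvK t01 Kx Kp).
rewrite opprD addrA (norm_subZE hip) -/c -/q => h.
nra.
Qed.

(** The angle at [p] is not acute, so |y - a|^2 is at least |y - p|^2 + |a - p|^2. *)
Lemma projection_dist_le (y p a : E) : ip (y - p) (a - p) <= 0 ->
  `|a - p| <= `|y - a|.
Proof.
move=> h.
rewrite -(@ler_pXn2r _ 2)// ?nnegrE//.
have -> : y - a = (y - p) - (a - p) by rewrite opprB addrA subrK.
rewrite [leRHS](norm_subE hip).
have := sqr_ge0 `|y - p|; lra.
Qed.

(** The hypothesis gives <x - y, p - y> >= |p - y|^2, so the squared distance to [x] drops by at
    least t(2 - t)|p - y|^2. *)
Lemma dist_toward_projection (y p x : E) (t : R) : 0 <= t <= 1 ->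
  ip (y - p) (x - p) <= 0 -> `|x - (y + t *: (p - y))| <= `|x - y|.
Proof.
move=> /andP[t0 t1] h.
rewrite -(@ler_pXn2r _ 2)// ?nnegrE//.
rewrite opprD addrA (norm_subZE hip).
have -> : ip (x - y) (p - y) = `|p - y| ^+ 2 - ip (y - p) (x - p).
  have -> : x - y = (x - p) + (p - y) by rewrite addrA subrK.
  rewrite (ipDl hip) (ipxx hip) addrC; congr (_ + _).
  by rewrite (ipC hip) -(opprB y p) (ipNl hip).
have P0 := sqr_ge0 `|p - y|.
have h1 : 0 <= t * `|p - y| ^+ 2 * (2 - t) by rewrite !mulr_ge0//; lra.
have h2 : 0 <= t * - ip (y - p) (x - p) by rewrite mulr_ge0//; lra.
nra.
Qed.

End projection.

(** * Borel sets, support and moments *)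

Section borel.
Context (R : realType) (E : normedModType R).

Lemma open_borelE (U : set E) : open U -> measurable (U : set (borelE E)).
Proof. by move=> oU; exact: sub_sigma_algebra. Qed.

Lemma closed_borelE (F : set E) : closed F -> measurable (F : set (borelE E)).
Proof.
move=> cF; rewrite -[F]setCK; apply: measurableC; apply: open_borelE.
exact: closed_openC.
Qed.

Lemma set1_borelE (x : E) : measurable ([set x] : set (borelE E)).
Proof.
apply: closed_borelE; apply: accessible_closed_set1.
exact/hausdorff_accessible/norm_hausdorff.
Qed.

Lemma continuous_borelE (f : E -> R) : continuous f ->
  measurable_fun setT (f : borelE E -> R).
Proof.
move=> cf.
apply: (measurability _ (RGenOInfty.measurableE R)) => _ [_ [a ->] <-].
rewrite setTI; apply: open_borelE.
by move/continuousP : cf; apply; exact: interval_open.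
Qed.

Lemma dist_continuous (y : E) : continuous (fun x : E => `|x - y|).
Proof.
by move=> x; apply: cvg_norm; apply: cvgB; [exact: cvg_id|exact: cvg_cst].
Qed.

Lemma measurable_dist (y : E) :
  measurable_fun setT (fun x : borelE E => `|(x : E) - y|).
Proof. exact: (continuous_borelE (@dist_continuous y)). Qed.

Lemma measurable_dist_powR (y : E) (r : R) :
  measurable_fun setT (fun x : borelE E => `|(x : E) - y| `^ r).
Proof.
by apply: (measurableT_comp (@measurable_powR R r)); exact: measurable_dist.
Qed.

Lemma measurable_bigmin (n : nat) (a : 'I_n -> E) (r : R) :
  measurable_fun setT (fun x : borelE E =>
    \big[Order.min/+oo%E]_(i < n) ((`|(x : E) - a i| `^ r)%:E)).
Proof.
elim: (index_enum _) => [|j s ih].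
  by under eq_fun do rewrite big_nil; exact: measurable_cst.
under eq_fun do rewrite big_cons.
apply: measurable_mine => //.
by apply/measurable_EFinP; exact: measurable_dist_powR.
Qed.

Lemma closed_supp (P : set (borelE E) -> \bar R) : closed (supp P).
Proof.
rewrite -[supp P]setCK; apply: open_closedC.
rewrite openE => x /= /existsNP[U /not_implyP[oU /not_implyP[Ux PU]]].
rewrite /interior nbhsE; exists U; first by [].
by move=> y Uy /(_ U oU Uy).
Qed.

Lemma closed_voronoiV (n : nat) (a : 'I_n -> E) i : closed (voronoiV a i).
Proof.
rewrite (_ : voronoiV a i =
    \bigcap_j [set x | `|x - a i| - `|x - a j| <= 0]); last first.
  apply/seteqP; split=> x xV j => [_ /=|]; first by rewrite subr_le0; exact: xV.
  by have := xV j Logic.I; rewrite /= subr_le0.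
apply: closed_bigI => j _.
apply: (@closed_comp _ _ (fun x => `|x - a i| - `|x - a j|) [set t | t <= 0]).
  by move=> x _; apply: cvgB; exact: dist_continuous.
exact: closed_le.
Qed.

Lemma open_voronoiW (n : nat) (a : 'I_n -> E) i : open (voronoiW a i).
Proof.
rewrite openE => x xW; apply: filter_forall => j.
have [aji|aji] := eqVneq (a j) (a i); first by near=> z.
have : open [set z | `|z - a i| - `|z - a j| < 0].
  apply: (@open_comp _ _ (fun x => `|x - a i| - `|x - a j|) [set t | t < 0]).
    by move=> z _; apply: cvgB; exact: dist_continuous.
  exact: open_lt.
rewrite openE => /(_ x) /=; rewrite subr_lt0 => /(_ (xW j (elimN eqP aji))).
by apply: filterS => z /=; rewrite subr_lt0.
Unshelve. all: by end_near. Qed.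

Lemma voronoiW_self (n : nat) (a : 'I_n -> E) i : voronoiW a i (a i).
Proof.
by move=> j /eqP; rewrite subrr normr0 normr_gt0 subr_eq0 eq_sym.
Qed.

Lemma voronoiWV (n : nat) (a : 'I_n -> E) i : voronoiW a i `<=` voronoiV a i.
Proof.
move=> x xW j; have [->//|/eqP aji] := eqVneq (a j) (a i).
by rewrite ltW// xW.
Qed.

End borel.

Section moments.
Context (R : realType) (E : normedModType R) (P : probability (borelE E) R).

(** Inner regularity reduces the claim to compact sets disjoint from the support; each is covered by
    finitely many null open sets. *)
Lemma radon_supp_full : radon P -> P (~` (supp P : set (borelE E))) = 0%E.
Proof.
move=> hrad.
have mK : measurable (~` supp P : set (borelE E)).
  by apply: measurableC; apply: closed_borelE; exact: closed_supp.
apply/eqP; rewrite -measure_le0 [leLHS](hrad _ mK).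
apply: ub_ereal_sup => _ [K [cK KS] <-].
have U_ (x : E) : exists U : set E, ~ supp P x -> [/\ open U, U x & P U = 0%E].
  have [xs|/existsNP[U /not_implyP[oU /not_implyP[Ux PU]]]] := pselect (supp P x).
    by exists setT.
  exists U => _; split => //; apply/eqP; rewrite -measure_le0 leNgt; exact/negP.
have /choice[f fP] := U_.
move: (cK); rewrite compact_cover => /(_ E (~` supp P) f).
case.
- by move=> x /fP[].
- by move=> x Kx; exists x; [exact: KS|case: (fP x (KS _ Kx))].
move=> D DS KD.
have mK' : measurable (K : set (borelE E)).
  by apply: closed_borelE; apply: (@compact_closed E) => //; exact: norm_hausdorff.
rewrite measure_le0; apply/eqP/negligibleP => //.
apply: (@negligibleS _ (borelE E) R P _ _ KD); rewrite /cover bigcup_fset big_seq.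
elim/big_ind : _ => [|A B|x /DS].
- exact: negligible_set0.
- exact: negligibleU.
- rewrite inE => /fP[oU _ PU]; exists (f x); split => //; exact: open_borelE.
Qed.

Lemma supp_nonempty : radon P -> supp P !=set0.
Proof.
move=> /radon_supp_full h; apply/set0P/eqP => s0; move: h.
rewrite s0 setC0 probability_setT => /eqP; by rewrite onee_eq0.
Qed.

Variable r : R.
Hypotheses (r0 : 0 < r) (hmom : (\int[P]_x ((`|(x : E)| `^ r)%:E) < +oo)%E).

(** Bounding s + t by twice the maximum covers every r > 0, including r < 1, where the power is not
    convex. *)
Lemma powRD_le (s t : R) : 0 <= s -> 0 <= t ->
  (s + t) `^ r <= 2 `^ r * (s `^ r + t `^ r).
Proof.
move=> s0 t0; apply: (@le_trans _ _ ((2 * Num.max s t) `^ r)).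
  apply: ge0_ler_powR; rewrite ?nnegrE ?addr_ge0 ?mulr_ge0 ?le_max ?s0 ?(ltW r0)//.
  have : s <= Num.max s t by rewrite le_max lexx.
  have : t <= Num.max s t by rewrite le_max lexx orbT.
  by lra.
rewrite powRM ?le_max ?s0// ler_wpM2l ?powR_ge0//.
by case: (leP s t) => _; rewrite (lerDl, lerDr) powR_ge0.
Qed.

Lemma integrable_dist_powR (D : set (borelE E)) (y : E) : measurable D ->
  P.-integrable D (fun x => (`|(x : E) - y| `^ r)%:E).
Proof.
move=> mD; apply: (@integrableS _ _ _ _ setT) => //.
have i0 : P.-integrable setT (fun x : borelE E => (`|x : E| `^ r)%:E).
  apply/integrableP; split.
    apply/measurable_EFinP; have := @measurable_dist_powR R E 0 r.
    by under eq_fun do rewrite subr0.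
  by under eq_integral do rewrite gee0_abs ?lee_fin ?powR_ge0//.
have ic : P.-integrable setT (fun _ : borelE E => (`|y| `^ r)%:E).
  by apply: finite_measure_integrable_cst.
have := integrableZl measurableT (2 `^ r) (integrableD measurableT i0 ic).
apply: le_integrable => //.
  by apply/measurable_EFinP; exact: measurable_dist_powR.
move=> x _ /=; rewrite lee_fin !ger0_norm ?mulr_ge0 ?addr_ge0 ?powR_ge0//.
apply: le_trans (powRD_le _ _) => //.
by apply: ge0_ler_powR; rewrite ?nnegrE ?addr_ge0 ?(ltW r0)//; exact: ler_normB.
Qed.

End moments.

(** * The distortion function *)

Section distortion.
Context (R : realType) (E : normedModType R) (P : probability (borelE E) R).
Variable r : R.
Hypotheses (r0 : 0 < r) (hmom : (\int[P]_x ((`|(x : E)| `^ r)%:E) < +oo)%E).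

Definition min_dist_powR (n : nat) (a : 'I_n -> E) (x : borelE E) : \bar R :=
  \big[Order.min/+oo%E]_(i < n) ((`|(x : E) - a i| `^ r)%:E).

Definition replace_center (n : nat) (a : 'I_n -> E) (i : 'I_n) (y : E) :=
  fun j => if j == i then y else a j.

Lemma replace_center_neq (n : nat) (a : 'I_n -> E) (i : 'I_n) (y : E) :
  y != a i -> replace_center a i y <> a.
Proof.
by move=> /eqP + /(congr1 (@^~ i)); rewrite /replace_center eqxx.
Qed.

Lemma replace_center_near (n : nat) (a : 'I_n -> E) (i : 'I_n) (y : E) (e : R) :
  `|y - a i| < e -> forall j, `|replace_center a i y j - a j| < e.
Proof.
move=> ye j; rewrite /replace_center; case: eqP => [->//|_].
by rewrite subrr normr0; exact: le_lt_trans ye.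
Qed.

Lemma measurable_min_dist_powR (D : set (borelE E)) (n : nat) (a : 'I_n -> E) :
  measurable_fun D (min_dist_powR a).
Proof. apply: measurable_funTS; exact: measurable_bigmin. Qed.

Lemma min_dist_powR_ge0 (n : nat) (a : 'I_n -> E) x : (0 <= min_dist_powR a x)%E.
Proof. by apply: le_bigmin => // i _; rewrite lee_fin powR_ge0. Qed.

Lemma ler_dist_powR (x y z : E) :
  `|x - y| <= `|x - z| -> `|x - y| `^ r <= `|x - z| `^ r.
Proof. by move=> h; apply: ge0_ler_powR; rewrite ?nnegrE// ltW. Qed.

Lemma min_dist_powR_le (n : nat) (a : 'I_n -> E) i (x : borelE E) :
  (min_dist_powR a x <= (`|(x : E) - a i| `^ r)%:E)%E.
Proof. exact: (@bigmin_le _ (\bar R) _ _ i). Qed.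

Lemma le_min_dist_powR (n m : nat) (a : 'I_n -> E) (b : 'I_m -> E) (x : borelE E) :
  (forall j, exists k, `|(x : E) - b k| <= `|(x : E) - a j|) ->
  (min_dist_powR b x <= min_dist_powR a x)%E.
Proof.
move=> h; apply: le_bigmin => [|j _]; first exact: leey.
have [k hk] := h j; apply: (le_trans (min_dist_powR_le b k x)).
by rewrite lee_fin ler_dist_powR.
Qed.

Lemma min_dist_powR_voronoiV (n : nat) (a : 'I_n -> E) i (x : borelE E) :
  voronoiV a i x -> min_dist_powR a x = (`|(x : E) - a i| `^ r)%:E.
Proof.
move=> xV; apply/eqP; rewrite eq_le min_dist_powR_le /=.
by apply: le_bigmin => [|j _]; [exact: leey|rewrite lee_fin ler_dist_powR].
Qed.

(** Since [P] does not charge the complement of its support, it suffices to compare the two families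
    of centers as seen from points of the support. *)
Lemma le_distortion (n m : nat) (a : 'I_n -> E) (b : 'I_m -> E) : radon P ->
  (forall x, supp P x -> forall j, exists k, `|x - b k| <= `|x - a j|) ->
  (distortion P r b <= distortion P r a)%E.
Proof.
move=> hrad h; apply: ae_ge0_le_integral => //.
- by move=> x _; exact: min_dist_powR_ge0.
- exact: measurable_min_dist_powR.
- by move=> x _; exact: min_dist_powR_ge0.
- exact: measurable_min_dist_powR.
exists (~` supp P); split.
- by apply: measurableC; apply: closed_borelE; exact: closed_supp.
- exact: radon_supp_full.
move=> x /= /not_implyP[_ xba] sx; apply: xba.
by apply: le_min_dist_powR; exact: h.
Qed.

Variables (n : nat) (a : 'I_n -> E).
Hypothesis hmin : strict_local_min (distortion P r (n:=n)) a.

(** If the point a_j is also occupied by another index, moving the j-th copy leaves that point among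
    the centers, so the distortion does not increase, against strictness. The vector [v] supplies a
    direction in which to move. *)
Lemma strict_local_min_inj (v : E) : v != 0 -> radon P -> injective a.
Proof.
case: hmin => e e0 hG v0 hrad i j aij; apply/eqP/negPn/negP => ij.
have vn : 0 < `|v| by rewrite normr_gt0.
(* A point at distance exactly e/2 from a_j: inside the neighbourhood, yet different from a_j. *)
pose y := a j + (e / 2 / `|v|) *: v.
have ya : y - a j = (e / 2 / `|v|) *: v by rewrite addrC addKr.
have yn : `|y - a j| = e / 2.
  rewrite ya normrZ gtr0_norm ?divr_gt0//.
  by rewrite divfK// gt_eqF.
have := hG (replace_center a j y).
have -> : (distortion P r a < distortion P r (replace_center a j y))%E = false.
  apply/negbTE; rewrite -leNgt; apply: le_distortion => // x _ k.
  have [->|kj] := eqVneq k j.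
    by exists i; rewrite /replace_center (negbTE ij) aij.
  by exists k; rewrite /replace_center (negbTE kj).
move=> H; have // : false; apply: H.
- by apply: replace_center_near; rewrite yn; lra.
- by apply: replace_center_neq; rewrite -subr_eq0 -normr_gt0 yn divr_gt0.
Qed.

(** Move a_i to [y] and split the distortion along [C]. On [C] the old integrand is |x - a_i|^r and
    the new one is at most |x - y|^r; off [C] the integrand does not increase, because another
    center already serves [x] at least as well as a_i. *)
Lemma strict_local_min_cell (i : 'I_n) (C : set (borelE E)) : measurable C ->
  voronoiW a i `<=` C -> C `<=` voronoiV a i ->
  exists2 e : R, 0 < e & forall y, `|y - a i| < e ->
    (\int[P]_(x in C) ((`|(x : E) - a i| `^ r)%:E) <=
     \int[P]_(x in C) ((`|(x : E) - y| `^ r)%:E))%E.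
Proof.
move=> mC WC CV; case: hmin => e e0 hG; exists e => // y ye.
have [->|yai] := eqVneq y (a i); first by [].
pose b := replace_center a i y.
have mf z : measurable_fun setT (fun x : borelE E => (`|(x : E) - z| `^ r)%:E).
  by apply/measurable_EFinP; exact: measurable_dist_powR.
have dis (c : 'I_n -> E) : distortion P r c =
    (\int[P]_(x in C) min_dist_powR c x + \int[P]_(x in ~` C) min_dist_powR c x)%E.
  rewrite -ge0_integral_setU ?setUv//; first exact: measurableC.
  - exact: measurable_min_dist_powR.
  - by move=> x _; exact: min_dist_powR_ge0.
  - by apply/disj_setPS; rewrite setICr.
have aC : (\int[P]_(x in C) min_dist_powR a x =
    \int[P]_(x in C) ((`|(x : E) - a i| `^ r)%:E))%E.
  apply: eq_integral => x; rewrite inE => /CV; exact: min_dist_powR_voronoiV.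
have bC : (\int[P]_(x in C) min_dist_powR b x <=
    \int[P]_(x in C) ((`|(x : E) - y| `^ r)%:E))%E.
  apply: ge0_le_integral => //.
  - by move=> x _; exact: min_dist_powR_ge0.
  - exact: measurable_min_dist_powR.
  - exact: measurable_funTS.
  - move=> x _; apply: (le_trans (min_dist_powR_le b i x)).
    by rewrite /b /replace_center eqxx.
have bN : (\int[P]_(x in ~` C) min_dist_powR b x <=
    \int[P]_(x in ~` C) min_dist_powR a x)%E.
  apply: ge0_le_integral => //.
  - exact: measurableC.
  - by move=> x _; exact: min_dist_powR_ge0.
  - exact: measurable_min_dist_powR.
  - exact: measurable_min_dist_powR.
  move=> x xC; apply: le_min_dist_powR => k.
  have [{k}->|ki] := eqVneq k i; last first.
    by exists k; rewrite /b /replace_center (negbTE ki).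
  (* Off the open cell, a center located elsewhere than a_i is at least as close to [x], and the
     replacement keeps it. *)
  have /existsNP[j /not_implyP[aji /negP]] : ~ voronoiW a i x by move=> /WC.
  rewrite -leNgt => xji; exists j; rewrite /b /replace_center.
  by have [ji|//] := eqVneq j i; case: aji; rewrite ji.
(* The common bound off [C] can be cancelled only because it is finite; the r-th moment gives
   this. *)
have fin : (\int[P]_(x in ~` C) min_dist_powR a x)%E \is a fin_num.
  have mN : measurable (~` C) by exact: measurableC.
  rewrite ge0_fin_numE; last by apply: integral_ge0 => x _; exact: min_dist_powR_ge0.
  have /integrableP[_] := integrable_dist_powR r0 hmom (a i) mN.
  apply: le_lt_trans; apply: ge0_le_integral => //.
  - by move=> x _; exact: min_dist_powR_ge0.
  - exact: measurable_min_dist_powR.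
  - by apply: measurableT_comp => //; exact: measurable_funTS.
  - by move=> x _; rewrite gee0_abs ?lee_fin ?powR_ge0//; exact: min_dist_powR_le.
have := hG b (replace_center_near ye) (replace_center_neq yai).
rewrite !dis aC => /ltW h; rewrite -(leeD2rE _ _ fin).
by apply: (le_trans h); exact: leeD.
Qed.

End distortion.

(** * Convexity and directional derivatives of the powers of the norm *)

Section norm_powR.
Context (R : realType) (E : normedModType R).
Variable r : R.
Hypothesis r1 : 1 <= r.

(** Triangle inequality, then monotonicity and convexity of s^r on s >= 0. *)
Lemma dist_powR_convex (t : R) (x y z : E) : 0 <= t <= 1 ->
  `|x - (z + t *: (y - z))| `^ r <=
  t * `|x - y| `^ r + (1 - t) * `|x - z| `^ r.
Proof.
move=> /andP[t0 t1]; have t1' : 0 <= 1 - t by rewrite subr_ge0.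
have h : (t * `|x - y| + (1 - t) * `|x - z|) `^ r <=
    t * `|x - y| `^ r + (1 - t) * `|x - z| `^ r.
  by apply: (convex_powR r1 (Itv01 t0 t1)); rewrite inE/= in_itv/= normr_ge0.
apply: le_trans h.
apply: ge0_ler_powR; rewrite ?nnegrE ?addr_ge0 ?mulr_ge0 ?normr_ge0//.
  exact: le_trans r1.
have -> : x - (z + t *: (y - z)) = t *: (x - y) + (1 - t) *: (x - z).
  rewrite scalerBl scale1r addrCA -scalerBr.
  have -> : x - y - (x - z) = - (y - z) by rewrite !opprB addrC addrA subrK.
  by rewrite scalerN opprD addrA.
by rewrite (le_trans (ler_normD _ _))// !normrZ !ger0_norm.
Qed.

(** A convex function has a smaller slope over [0, t] than over [0, 1]. Together with the next bound
    this dominates the difference quotients uniformly in [t]. *)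
Lemma dist_powR_slope_le (t : R) (x a u : E) : 0 < t <= 1 ->
  t^-1 * (`|x - (a + t *: u)| `^ r - `|x - a| `^ r) <=
  `|x - (a + u)| `^ r - `|x - a| `^ r.
Proof.
move=> /andP[t0 t1]; rewrite ler_pdivrMl//.
have t01 : 0 <= t <= 1 by rewrite ltW.
by have := dist_powR_convex x (a + u) a t01; rewrite addrAC subrr add0r; lra.
Qed.

(** As [a] is the midpoint of a + tu and a - tu, convexity makes the slopes along u and -u sum to a
    nonnegative number; the slope along -u is bounded by the previous lemma. *)
Lemma dist_powR_slope_ge (t : R) (x a u : E) : 0 < t <= 1 ->
  - (`|x - (a - u)| `^ r - `|x - a| `^ r) <=
  t^-1 * (`|x - (a + t *: u)| `^ r - `|x - a| `^ r).
Proof.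
move=> t01; have := dist_powR_slope_le x a (- u) t01.
rewrite scalerN; case/andP : t01 => t0 _.
have hh : 0 <= (1 / 2 : R) <= 1 by apply/andP; split; lra.
have := dist_powR_convex x (a - t *: u) (a + t *: u) hh.
have -> : a + t *: u + (1 / 2) *: (a - t *: u - (a + t *: u)) = a.
  have -> : a - t *: u - (a + t *: u) = - 2 *: (t *: u).
    by rewrite opprD addrACA subrr add0r -opprD -mulr2n -scaler_nat scaleNr.
  by rewrite scalerA mulrN div1r mulVf// scaleN1r addrK.
rewrite -(ler_pM2l (_ : 0 < t^-1)) ?invr_gt0// => h1 h2.
by move: h1 h2; rewrite !mulrDr; lra.
Qed.

Variable ip : E -> E -> R.
Hypothesis hip : is_hilbert_inner ip.

Lemma norm_powR_sqr (z : E) (s : R) : (`|z| ^+ 2) `^ (s / 2) = `|z| `^ s.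
Proof. by rewrite -powR_mulrn// -powRrM mulrC divfK. Qed.

(** For x != a the r-th power of the distance is q(t)^(r/2) with q quadratic and q(0) > 0, and the
    chain rule applies. At x = a with r > 1 the quotient is t^(r-1) |u|^r, which tends to 0. *)
Lemma dist_powR_deriv (x a u : E) : x != a \/ 1 < r ->
  t^-1 * (`|x - (a + t *: u)| `^ r - `|x - a| `^ r) @[t --> (0:R)^'+] -->
  r * (`|x - a| `^ (r - 1) * (ip (a - x) u / `|a - x|)).
Proof.
have [->|xa _] := eqVneq x a.
  case=> // r1'.
  (* The claimed limit is 0 here by the convention that the inverse of 0 is 0. *)
  rewrite subrr normr0 invr0 !mulr0 powR0; last by rewrite gt_eqF// (lt_le_trans _ r1).
  have : (fun t : R => t `^ (r - 1) * `|u| `^ r) t @[t --> (0:R)^'+] --> 0 * `|u| `^ r.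
    by apply: cvgMl; apply: powR_cvg0; rewrite subr_gt0.
  rewrite mul0r; apply: cvg_trans; apply: near_eq_cvg; near=> t.
  have t0 : 0 < t by near: t; exact: nbhs_right_gt.
  rewrite subr0 opprD addrA subrr add0r normrN normrZ gtr0_norm//.
  rewrite powRM ?(ltW t0)// -(mulr_powRB1 (ltW t0) (lt_le_trans ltr01 r1)).
  by rewrite -!mulrA mulKf// gt_eqF.
have xa0 : 0 < `|x - a| by rewrite normr_gt0 subr_eq0.
pose q (t : R) := `|x - a| ^+ 2 - 2 * t * ip (x - a) u + t ^+ 2 * `|u| ^+ 2.
have hq t : `|x - (a + t *: u)| `^ r = q t `^ (r / 2).
  by rewrite -norm_powR_sqr opprD addrA (norm_subZE hip).
have q0 : q 0 = `|x - a| ^+ 2 by rewrite /q; ring.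
have dq : is_derive (0:R) (1:R) q (- 2 * ip (x - a) u).
  have dq : h^-1 *: ((q \o shift (0:R)) (h *: (1:R)) - q 0) @[h --> (0:R)^'] -->
      - 2 * ip (x - a) u + 0 * `|u| ^+ 2.
    apply: (@cvg_trans _ ((- 2 * ip (x - a) u + h * `|u| ^+ 2) @[h --> (0:R)^'])).
      apply: near_eq_cvg; near=> h.
      have h0 : h != 0 by near: h; exact: nbhs_dnbhs_neq.
      rewrite /= addr0 q0 /q /GRing.scale /=; by field.
    apply: cvgD; first exact: cvg_cst.
    by apply: cvgMl; apply: cvg_within_filter.
  rewrite mul0r addr0 in dq.
  by apply: DeriveDef; [apply/cvg_ex; eexists; exact: dq|exact: cvg_lim].
have q0gt : 0 < q 0 by rewrite q0 exprn_gt0.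
have dp := is_derive1_comp (is_derive1_powR (r / 2) q0gt) dq.
have [dd <-] : derivable ((powR (R:=R))^~ (r / 2) \o q) 0 1 /\
  'D_1 ((powR (R:=R))^~ (r / 2) \o q) 0 =
   r * (`|x - a| `^ (r - 1) * (ip (a - x) u / `|a - x|)).
  split; first by case: dp.
  rewrite (@derive_val _ _ _ _ _ _ _ dp).
  rewrite q0 (_ : r / 2 - 1 = (r - 2) / 2); last by field.
  rewrite norm_powR_sqr.
  have -> : `|x - a| `^ (r - 1) = `|x - a| `^ (r - 2) * `|x - a|.
    rewrite (_ : r - 1 = (r - 2) + 1); last by ring.
    rewrite powRD; last by rewrite (gt_eqF xa0) implybT.
    by rewrite powRr1.
  rewrite (distrC a x) -(opprB x a) (ipNl hip); field.
  by rewrite gt_eqF.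
have := cvg_dnbhs_at_right dd; rewrite -/(derive _ _ _).
apply: cvg_trans; apply: near_eq_cvg; near=> t.
rewrite /= hq addr0 /GRing.scale /= mulr1 q0 -(norm_powR_sqr (x - a) r).
by [].
Unshelve. all: by end_near. Qed.

End norm_powR.

(** * First-order condition for a minimizer of the integrated power of the distance *)

Section stationarity.
Context (R : realType) (E : normedModType R) (ip : E -> E -> R).
Hypothesis hip : is_hilbert_inner ip.
Variables (P : probability (borelE E) R) (r : R).
Hypotheses (r1 : 1 <= r)
  (hmom : (\int[P]_x ((`|(x : E)| `^ r)%:E) < +oo)%E).

Let r0 : 0 < r. Proof. exact: lt_le_trans r1. Qed.

(** Up to the factor [r], the derivative of |x - .|^r at [a] along [u]; at x = a the convention on
    the inverse of 0 makes it 0. *)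
Definition grad_dist_powR (a u : E) (x : borelE E) : R :=
  `|(x : E) - a| `^ (r - 1) * (ip (a - x) u / `|a - x|).

Lemma measurable_grad_dist_powR (a u : E) :
  measurable_fun setT (grad_dist_powR a u).
Proof.
apply: measurable_funM; first exact: measurable_dist_powR.
apply: measurable_funM.
  apply: (@continuous_borelE _ _ (fun x => ip (a - x) u)) => x.
  apply: (@continuous_comp _ _ _ (fun x => a - x) (ip^~ u)).
    by apply: cvgB; [exact: cvg_cst|exact: cvg_id].
  exact: (ip_continuous hip).
rewrite (_ : (fun x => _) = (fun x : borelE E => `|(x : E) - a| `^ (-1))).
  exact: measurable_dist_powR.
by apply/funext => x; rewrite powR_inv1// distrC.
Qed.

Lemma grad_dist_powRN (a u : E) x :
  grad_dist_powR a (- u) x = - grad_dist_powR a u x.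
Proof. by rewrite /grad_dist_powR (ipNr hip) mulNr mulrN. Qed.

Lemma grad_dist_powR_self (a u : E) : grad_dist_powR a u a = 0.
Proof. by rewrite /grad_dist_powR subrr normr0 invr0 !mulr0. Qed.

Variables (a : E) (C : set (borelE E)).
Hypotheses (mC : measurable C) (a1 : r = 1 -> P [set a] = 0%E).
Hypothesis amin : forall y,
  (\int[P]_(x in C) ((`|(x : E) - a| `^ r)%:E) <=
   \int[P]_(x in C) ((`|(x : E) - y| `^ r)%:E))%E.

Let slope (u : E) (t : R) (x : borelE E) : R :=
  t^-1 * (`|(x : E) - (a + t *: u)| `^ r - `|(x : E) - a| `^ r).

Let slope_integral_ge0 (u : E) (t : R) : 0 < t ->
  (0 <= \int[P]_(x in C) ((slope u t x)%:E))%E.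
Proof.
move=> t0; have ia y := integrable_dist_powR r0 hmom y mC.
under eq_integral do rewrite EFinM EFinB.
rewrite integralZl//; last exact: integrableB.
apply: mule_ge0; first by rewrite lee_fin invr_ge0 ltW.
rewrite integralB// sube_ge0//.
by rewrite integrable_fin_num.
Qed.

(** Minimality makes every difference quotient of positive step have a nonnegative integral;
    dominated convergence along the steps 1/(k+1) carries this to the derivative and yields its
    integrability. *)
Lemma grad_dist_powR_integral_ge0 (u : E) :
  P.-integrable C (fun x => (grad_dist_powR a u x)%:E) /\
  (0 <= \int[P]_(x in C) (grad_dist_powR a u x)%:E)%E.
Proof.
have ia y := integrable_dist_powR r0 hmom y mC.
(* A single majorant for the upper and the lower slope bound. *)
pose g x : \bar R := ((`|(x : E) - (a + u)| `^ r)%:E +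
  (`|(x : E) - (a - u)| `^ r)%:E + (`|(x : E) - a| `^ r)%:E)%E.
have ig : P.-integrable C g by do 2! [apply: integrableD => //].
have mslope n : measurable_fun C (fun x => (slope u (harmonic n) x)%:E).
  apply: measurable_funTS; apply/measurable_EFinP; apply: measurable_funM => //.
  by apply: measurable_funB; exact: measurable_dist_powR.
have mlim : measurable_fun C (fun x => (r * grad_dist_powR a u x)%:E).
  apply: measurable_funTS; apply/measurable_EFinP; apply: measurable_funM => //.
  exact: measurable_grad_dist_powR.
have h01 n : 0 < (harmonic n : R) <= 1.
  by rewrite /= invr_gt0 ltr0n /= invf_le1 ?ler1n ?ltr0n.
have cvgs (x : E) : x != a \/ 1 < r ->
    (slope u (harmonic n) x)%:E @[n --> \oo] --> (r * grad_dist_powR a u x)%:E.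
  move=> xa; have := dist_powR_deriv r1 hip (u := u) xa.
  move=> /cvg_at_rightP /(_ (@harmonic R)) h.
  apply/cvg_EFin; first by near=> n.
  apply: h; split; last exact: cvg_harmonic.
  by move=> n; case/andP: (h01 n).
have [] := dominated_convergence mC mslope mlim _ ig.
(* For r = 1 the quotients may fail to converge at x = a, a null point by [a1]. *)
- have [r1'|] := ltP 1 r; first by apply: aeW => x _; apply: cvgs; right.
  move=> r1'; have re1 : r = 1 by apply/eqP; rewrite eq_le r1' r1.
  exists [set a]; split; [exact: set1_borelE|exact: a1|].
  move=> x /= /not_implyP[_ ncv]; apply/eqP/negPn/negP => xa.
  by apply: ncv; apply: cvgs; left.
- apply: aeW => x n _; rewrite /g -!EFinD abse_EFin lee_fin ler_norml.
  have := dist_powR_slope_le r1 x a u (h01 n).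
  have := dist_powR_slope_ge r1 x a u (h01 n).
  rewrite -/(slope u (harmonic n) x).
  have := powR_ge0 `|(x:E) - (a + u)| r; have := powR_ge0 `|(x:E) - (a - u)| r.
  have := powR_ge0 `|(x:E) - a| r.
  by move=> *; apply/andP; split; lra.
move=> ilim _ cvgi.
have gE x : (grad_dist_powR a u x)%:E = (r^-1%:E * (r * grad_dist_powR a u x)%:E)%E.
  by rewrite -EFinM mulKf// gt_eqF.
split.
  by under eq_fun do rewrite gE; exact: integrableZl.
under eq_integral do rewrite gE.
rewrite integralZl//; apply: mule_ge0; first by rewrite lee_fin invr_ge0 ltW.
rewrite -(cvg_lim _ cvgi)//; apply: lime_ge.
  by apply/cvg_ex; eexists; exact: cvgi.
by near=> n; apply: slope_integral_ge0; case/andP: (h01 n).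
Unshelve. all: by end_near. Qed.

(** The derivative is odd in [u], so the inequalities for u and -u combine to an equality. *)
Lemma grad_dist_powR_integral0 (u : E) :
  P.-integrable C (fun x => (grad_dist_powR a u x)%:E) /\
  (\int[P]_(x in C) (grad_dist_powR a u x)%:E = 0)%E.
Proof.
have [iu u0] := grad_dist_powR_integral_ge0 u; split => //.
have [_] := grad_dist_powR_integral_ge0 (- u).
under eq_integral do rewrite grad_dist_powRN EFinN.
rewrite integralN; last exact: integrable_add_def.
by rewrite oppe_ge0 => uN; apply/eqP; rewrite eq_le u0 uN.
Qed.

Lemma grad_dist_powR_integral0_setD1 (u : E) :
  P.-integrable (C `\ a) (fun x => (grad_dist_powR a u x)%:E) /\
  (\int[P]_(x in C `\ a) (grad_dist_powR a u x)%:E = 0)%E.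
Proof.
have [iC C0] := grad_dist_powR_integral0 u.
have mD : measurable (C `\ a) by apply: measurableD => //; exact: set1_borelE.
split; first by apply: integrableS iC => //; exact: subDsetl.
rewrite -C0 [LHS]integral_mkcond [RHS]integral_mkcond; apply: eq_integral => x _.
rewrite /patch; case: ifPn => [|].
  by rewrite inE => -[Cx _]; rewrite mem_set.
rewrite notin_setE => xD; case: ifPn => // /set_mem Cx.
have -> : x = a by apply/not_notP => xa; apply: xD.
by rewrite grad_dist_powR_self.
Qed.

End stationarity.

(** * Voronoi cells *)

Section voronoi_cells.
Context (R : realType) (E : normedModType R) (n : nat) (a : 'I_n -> E).
Implicit Types i j : 'I_n.

(** Ties between nearest centers go to the least index, which makes the cells disjoint. *)
Definition first_voronoi_cell i : set (borelE E) :=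
  voronoiV a i `\` \bigcup_(j in [set j : 'I_n | (j < i)%N]) voronoiV a j.

Lemma voronoiWV_disjoint i j : a i != a j ->
  voronoiW a i `&` voronoiV a j = set0.
Proof.
move=> aij; apply/seteqP; split => // x [xW xV].
have : `|x - a i| < `|x - a j| by apply: xW; apply/eqP; rewrite eq_sym.
by rewrite ltNge xV.
Qed.

Lemma voronoi_partition_first : (0 < n)%N -> voronoi_partition a first_voronoi_cell.
Proof.
move=> n0; split.
- move=> i; apply: measurableD; first by apply: closed_borelE; exact: closed_voronoiV.
  apply: fin_bigcup_measurable => [|j _]; first exact: finite_finset.
  by apply: closed_borelE; exact: closed_voronoiV.
- move=> i j ij; apply/seteqP; split => // x [[xi ni] [xj nj]].
  have [lij|lji|/val_inj eij] := ltngtP i j.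
  + by apply: nj; exists i.
  + by apply: ni; exists j.
  + by move: ij; rewrite eij eqxx.
- apply/seteqP; split => // x _.
  pose i0 := Ordinal n0.
  have [i1 _ i1min] := @Order.TotalTheory.arg_minP _ R _ i0 xpredT
    (fun j => `|(x : E) - a j|) isT.
  have Vi1 : `[< voronoiV a i1 x >] by apply/asboolP => j; exact: i1min.
  case: (@arg_minnP _ i1 (fun j => `[< voronoiV a j x >]) (fun j => val j) Vi1)
    => i /asboolP iV imin.
  exists i => //; split => // -[j /= ji jV].
  by have := imin j (asboolT jV); rewrite leqNgt ji.
- by move=> i x [].
Qed.

Lemma voronoiW_sub_first i : injective a -> voronoiW a i `<=` first_voronoi_cell i.
Proof.
move=> inja x xW; split; first exact: voronoiWV.
move=> [j /= ji jV].
have aij : a i != a j.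
  by apply/eqP => /inja ij; move: ji; rewrite ij ltnn.
by have : set0 x by rewrite -(voronoiWV_disjoint aij).
Qed.

(** A nearest center to [x] that is not strictly nearest ties with a center at a different point,
    and both are then nearest. *)
Lemma voronoiW_cover : (0 < n)%N ->
  ~` (\bigcup_(i in [set: 'I_n]) voronoiW a i) `<=`
  \bigcup_(p in [set p : 'I_n * 'I_n | a p.1 != a p.2])
    (voronoiV a p.1 `&` voronoiV a p.2).
Proof.
move=> n0 x nW.
have [_ _ cov _] := voronoi_partition_first n0.
have [i _ [iV _]] : (\bigcup_(i in [set: 'I_n]) first_voronoi_cell i) x by rewrite cov.
have /existsNP[j /not_implyP[aji /negP]] : ~ voronoiW a i x.
  by move=> iW; apply: nW; exists i.
rewrite -leNgt => xji; exists (i, j) => /=; first by rewrite eq_sym; apply/eqP.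
by split => // k; exact: le_trans (iV k).
Qed.

End voronoi_cells.

(** * Stationarity on Voronoi cells and nullity of their boundaries *)

Lemma positive_integral0_null (d : measure_display) (T : measurableType d)
    (R : realType) (mu : {measure set T -> \bar R}) (D : set T) (h : T -> R) :
  measurable D -> measurable_fun D h -> (forall x, D x -> 0 < h x) ->
  (\int[mu]_(x in D) (h x)%:E = 0)%E -> mu D = 0%E.
Proof.
move=> mD mh h0 ih.
have : (\int[mu]_(x in D) `|(EFin \o h) x| = 0)%E.
  rewrite -[RHS]ih; apply: eq_integral => x; rewrite inE => Dx.
  by rewrite /= ger0_norm// ltW// h0.
move=> /ae_eq_integral_abs []//; first exact/measurable_EFinP.
move=> N [mN N0 DN]; apply/eqP; rewrite -measure_le0 -N0 le_measure ?inE//.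
move=> x Dx; apply: DN => /= /(_ Dx) [] hx; have := h0 _ Dx.
by rewrite hx ltxx.
Qed.

Section cells.
Context (R : realType) (E : normedModType R) (P : probability (borelE E) R).
Variable r : R.
Hypotheses (r1 : 1 <= r) (hmom : (\int[P]_x ((`|(x : E)| `^ r)%:E) < +oo)%E).

Let r0 : 0 < r. Proof. exact: lt_le_trans r1. Qed.

(** The conditional law unfolds to a scaled restriction of [P], so minimizing its distortion amounts
    to minimizing the integral over [C]. *)
Lemma distortion_condP (C : set (borelE E)) (y : E) : measurable C ->
  distortion (condP P C) r (fun _ : 'I_1 => y) =
  (((fine (P C))^-1)%:E * \int[P]_(x in C) ((`|(x : E) - y| `^ r)%:E))%E.
Proof.
move=> mC.
have k0 : 0 <= (fine (P C))^-1 by rewrite invr_ge0 fine_ge0.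
pose k := NngNum k0; pose m := mrestr P mC.
have mf : measurable_fun setT (fun x : borelE E => (`|(x : E) - y| `^ r)%:E).
  by apply/measurable_EFinP; exact: measurable_dist_powR.
have f0 (x : borelE E) : (0 <= (`|(x : E) - y| `^ r)%:E)%E.
  by rewrite lee_fin powR_ge0.
transitivity (\int[mscale k m]_x (`|(x : E) - y| `^ r)%:E)%E.
  transitivity (\int[mscale k m]_x min_dist_powR r (fun _ : 'I_1 => y) x)%E.
    by [].
  apply: eq_integral => x _.
  by rewrite (@min_dist_powR_voronoiV _ _ _ r0 _ _ ord0).
rewrite ge0_integral_mscale//=; congr (_ * _)%E.
rewrite -(setUv C) ge0_integral_setU//; last 3 first.
- exact: measurableC.
- by rewrite setUv.
- by apply/disj_setPS; rewrite setICr.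
rewrite [X in (_ + X)%E]null_set_integral; last 3 first.
- exact: measurableC.
- exact: measurable_funTS.
- by rewrite -[LHS]/(P (~` C `&` C)) setICl measure0.
rewrite adde0; apply: eq_measure_integral => A mA AC.
by rewrite -[LHS]/(P (A `&` C)) setIidl.
Qed.

Variables (n : nat) (a : 'I_n -> E).
Hypothesis hmin : strict_local_min (distortion P r (n:=n)) a.

(** A local minimum of a convex function is global: compare a_i with a point of the segment towards
    [y] that is close enough to a_i. *)
Lemma strict_local_min_cell_global (i : 'I_n) (C : set (borelE E)) :
  measurable C -> voronoiW a i `<=` C -> C `<=` voronoiV a i -> forall y,
  (\int[P]_(x in C) ((`|(x : E) - a i| `^ r)%:E) <=
   \int[P]_(x in C) ((`|(x : E) - y| `^ r)%:E))%E.
Proof.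
move=> mC WC CV y.
have [e e0 he] := strict_local_min_cell r0 hmom hmin mC WC CV.
have ia z := integrable_dist_powR r0 hmom z mC.
have [t [t0 t1 ty]] : exists t, [/\ 0 < t, t <= 1 & t * `|y - a i| < e].
  have ey : 0 < e + `|y - a i| by rewrite ltr_pwDl.
  (* This ratio stays in (0, 1] and brings the displacement below [e], with no separate case y =
     a_i. *)
  exists (e / (e + `|y - a i|)); split; first by rewrite divr_gt0.
    by rewrite ler_pdivrMr// mul1r lerDl.
  by rewrite mulrAC ltr_pdivrMr// ltr_pM2l// ltrDr.
have t01 : 0 <= t <= 1 by rewrite ltW.
have /he hb : `|a i + t *: (y - a i) - a i| < e.
  by rewrite addrAC subrr add0r normrZ gtr0_norm.
have : (\int[P]_(x in C) ((`|(x : E) - (a i + t *: (y - a i))| `^ r)%:E) <=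
    \int[P]_(x in C) (t%:E * (`|(x : E) - y| `^ r)%:E +
                      (1 - t)%:E * (`|(x : E) - a i| `^ r)%:E))%E.
  apply: ge0_le_integral => //.
  - by have /integrableP[] := ia (a i + t *: (y - a i)).
  - by apply: emeasurable_funD; apply: measurable_funeM;
      [have /integrableP[] := ia y|have /integrableP[] := ia (a i)].
  - by move=> x _; rewrite lee_fin; exact: dist_powR_convex.
have ity := integrableZl mC t (ia y).
have ita := integrableZl mC (1 - t) (ia (a i)).
rewrite (integralD mC ity ita) (integralZl mC (ia y)) (integralZl mC (ia (a i))).
move=> /(le_trans hb).
have fin z : exists I : R,
    (\int[P]_(x in C) ((`|(x : E) - z| `^ r)%:E) = I%:E)%E.
  by eexists; apply/esym/fineK; exact: integrable_fin_num (ia z).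
have [Iy ->] := fin y; have [Ia ->] := fin (a i).
rewrite -!EFinM -EFinD !lee_fin => h.
by rewrite -(ler_pM2l t0); lra.
Qed.

Variable ip : E -> E -> R.
Hypotheses (hip : is_hilbert_inner ip) (ha : r = 1 -> forall i, P [set a i] = 0%E).

(** Stationarity holds on the open cell and also on its disjoint union with the tie set; subtracting
    leaves the tie set. *)
Lemma grad_voronoiVI (i j : 'I_n) (u : E) : a i != a j ->
  P.-integrable (voronoiV a i `&` voronoiV a j)
    (fun x => (grad_dist_powR ip r (a i) u x)%:E) /\
  (\int[P]_(x in voronoiV a i `&` voronoiV a j)
     (grad_dist_powR ip r (a i) u x)%:E = 0)%E.
Proof.
move=> aij; pose D := voronoiV a i `&` voronoiV a j.
have mW : measurable (voronoiW a i : set (borelE E)).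
  by apply: open_borelE; exact: open_voronoiW.
have mD : measurable (D : set (borelE E)).
  by apply: measurableI; apply: closed_borelE; exact: closed_voronoiV.
have WV : voronoiW a i `|` D `<=` voronoiV a i.
  by move=> x [/voronoiWV|[]].
have mWD := measurableU _ _ mW mD.
have ai1 : r = 1 -> P [set a i] = 0%E by move=> /ha.
have [iW W0] := grad_dist_powR_integral0 hip r1 hmom mW ai1
  (strict_local_min_cell_global mW (fun _ => id) (@voronoiWV _ _ _ a i)) u.
have [iU U0] := grad_dist_powR_integral0 hip r1 hmom mWD ai1
  (strict_local_min_cell_global mWD (@subsetUl _ _ _) WV) u.
have iD : P.-integrable D (fun x => (grad_dist_powR ip r (a i) u x)%:E).
  by apply: integrableS iU => //; exact: subsetUr.
split => //; move: U0; rewrite integral_setU//.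
- by rewrite W0 add0e.
- by case/integrableP : iU.
- apply/disj_setPS; rewrite /D setIA (setIC (voronoiW _ _)) -setIA.
  by rewrite voronoiWV_disjoint// setI0.
Qed.

(** On the tie set both gradients carry the same weight, so with u = a_i - a_j their difference is
    that weight times |u|^2 > 0. Its integral vanishes by [grad_voronoiVI]. *)
Lemma voronoiVI_null (i j : 'I_n) : a i != a j ->
  P (voronoiV a i `&` voronoiV a j) = 0%E.
Proof.
move=> aij; pose u := a i - a j.
have mD : measurable (voronoiV a i `&` voronoiV a j : set (borelE E)).
  by apply: measurableI; apply: closed_borelE; exact: closed_voronoiV.
have [iI I0] := grad_voronoiVI u aij.
have aji : a j != a i by rewrite eq_sym.
have [iJ J0] := grad_voronoiVI u aji.
rewrite setIC in iJ J0.
apply: (@positive_integral0_null _ _ _ P _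
  (fun x => grad_dist_powR ip r (a i) u x - grad_dist_powR ip r (a j) u x)) => //.
- by apply: measurable_funTS; apply: measurable_funB; exact: measurable_grad_dist_powR.
- move=> x [xi xj].
  have xij : `|x - a i| = `|x - a j| by apply/eqP; rewrite eq_le xi xj.
  (* A tie at distance 0 would force a_i = a_j. *)
  have xi0 : 0 < `|x - a i|.
    rewrite normr_gt0; apply: contra aij => /eqP xai; rewrite -subr_eq0 -normr_le0.
    move/eqP : xij; rewrite xai normr0 eq_sym normr_eq0 => /eqP xaj.
    have -> : a i - a j = (x - a j) - (x - a i) by rewrite opprB [RHS]addrC addrA subrK.
    by rewrite xai xaj subrr normr0.
  rewrite /grad_dist_powR (distrC (a i)) (distrC (a j)) -xij.
  rewrite -mulrBr -mulrBl -(ipBl hip) opprB addrA subrK (ipxx hip).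
  by rewrite mulr_gt0 ?powR_gt0// divr_gt0// exprn_gt0// normr_gt0 subr_eq0.
under eq_integral do rewrite EFinB.
by rewrite integralB// I0 J0 sube0.
Qed.

Lemma voronoi_admissible : (0 < n)%N -> admissible P a.
Proof.
move=> n0; rewrite /admissible.
have mW : measurable (\bigcup_(i in [set: 'I_n]) voronoiW a i : set (borelE E)).
  apply: fin_bigcup_measurable => [|j _]; first exact: finite_finset.
  by apply: open_borelE; exact: open_voronoiW.
have mN := measurableC mW.
apply/eqP; rewrite -[X in P X == _]setCK probability_setC//.
suff -> : P (~` \bigcup_(i in [set: 'I_n]) voronoiW a i) = 0%E by rewrite sube0.
apply/negligibleP => //.
apply: (@negligibleS _ (borelE E) R P _ _ (voronoiW_cover (a := a) n0)).
rewrite -(bigsetU_fset_set _ finite_finset) big_seq.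
elim/big_ind : _ => [|A B|p].
- exact: negligible_set0.
- exact: negligibleU.
rewrite in_fset_set; last exact: finite_finset.
move=> /set_mem /= /voronoiVI_null p0.
exists (voronoiV a p.1 `&` voronoiV a p.2); split => //.
by apply: measurableI; apply: closed_borelE; exact: closed_voronoiV.
Qed.

End cells.

(** * Position of the centers in a convex support *)

Lemma convex_set_segment (R : realType) (E : normedModType R) (K : set E) :
  convex_set (K : set (convex_lmodType E)) ->
  forall x y (t : R), 0 <= t <= 1 -> K x -> K y -> K (y + t *: (x - y)).
Proof.
move=> cK x y t /andP[t0 t1] Kx Ky.
have := cK x y (Itv01 t0 t1); rewrite !inE => /(_ Kx Ky).
have -> // : conv (Itv01 t0 t1) (x : convex_lmodType E) y = y + t *: (x - y).
rewrite -[LHS]/(t *: x + (1 - t) *: y) scalerBl scale1r scalerBr.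
by rewrite addrCA.
Qed.

(** The homothety of center [a] and ratio [t] maps a ball of radius d around [c] contained in [K] to
    a ball of radius td, still in [K] by convexity. *)
Lemma interior_segment (R : realType) (E : normedModType R) (K : set E)
    (a c : E) (t : R) : 0 < t <= 1 ->
  (forall x y (t : R), 0 <= t <= 1 -> K x -> K y -> K (y + t *: (x - y))) ->
  K a -> interior K c -> interior K (a + t *: (c - a)).
Proof.
move=> /andP[t0 t1] cv Ka; rewrite /interior -!nbhs_ballE => -[d /= d0 dK].
exists (t * d); first by rewrite /= mulr_gt0.
move=> z; rewrite -ball_normE /= => zd.
have -> : z = a + t *: (c - t^-1 *: (a + t *: (c - a) - z) - a).
  rewrite addrAC scalerBr scalerA mulfV ?gt_eqF// scale1r.
  by rewrite opprB addrA [RHS]addrC subrK.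
apply: cv => //; first by rewrite (ltW t0).
apply: dK; rewrite -ball_normE /= opprB addrC subrK normrZ gtr0_norm ?invr_gt0//.
by rewrite ltr_pdivrMl.
Qed.

Section convex_support.
Context (R : realType) (E : completeNormedModType R) (ip : E -> E -> R).
Hypothesis hip : is_hilbert_inner ip.
Variables (P : probability (borelE E) R) (r : R).
Hypotheses (hrad : radon P) (r0 : 0 < r).
Hypothesis cvK : forall x y (t : R), 0 <= t <= 1 -> supp P x -> supp P y ->
  supp P (y + t *: (x - y)).
Variables (n : nat) (a : 'I_n -> E).
Hypothesis hmin : strict_local_min (distortion P r (n:=n)) a.

Let K0 := supp_nonempty hrad.
Let clK := @closed_supp R E P.

(** A center outside the support could be moved a little towards its projection without getting
    farther from any point of the support, against strictness. *)
Lemma strict_local_min_supp i : supp P (a i).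
Proof.
have [e e0 he] := hmin; apply: contrapT => Kai.
have [p Kp hp] := hilbert_projection hip K0 clK cvK (a i).
have pai : p - a i != 0.
  by rewrite subr_eq0; apply/eqP => pa; apply: Kai; rewrite -pa.
pose t := e / (e + `|p - a i|).
have ep : 0 < e + `|p - a i| by rewrite ltr_pwDl.
have t0 : 0 < t by rewrite divr_gt0.
have t1 : t <= 1 by rewrite ler_pdivrMr// mul1r lerDl.
pose y := a i + t *: (p - a i).
have yE : y - a i = t *: (p - a i) by rewrite /y addrAC subrr add0r.
have ye : `|y - a i| < e.
  rewrite yE normrZ gtr0_norm// /t mulrAC ltr_pdivrMr//.
  by rewrite ltr_pM2l// ltrDr.
have ya : y != a i.
  by rewrite -subr_eq0 yE scaler_eq0 negb_or pai gt_eqF.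
have := he _ (replace_center_near ye) (replace_center_neq ya).
apply/negP; rewrite -leNgt; apply: le_distortion => // x Kx j.
exists j; rewrite /replace_center; case: eqP => [->|//].
apply: (dist_toward_projection hip); last exact: hp.
by rewrite (ltW t0) t1.
Qed.

End convex_support.

(** * Centers in the interior of the support *)

Section interior_of_support.
Context (R : realType) (E : completeNormedModType R) (ip : E -> E -> R).
Hypothesis hip : is_hilbert_inner ip.
Variables (P : probability (borelE E) R) (r : R).
Hypotheses (hrad : radon P) (r2 : 2 <= r)
  (hmom : (\int[P]_x ((`|(x : E)| `^ r)%:E) < +oo)%E).
Local Notation K := (supp P : set E).
Hypothesis cvK : forall x y (t : R), 0 <= t <= 1 -> K x -> K y ->
  K (y + t *: (x - y)).

(** This is |x - a|^(r-2) away from [a]; the quotient form gives 0 at [a], also for r = 2, in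
    agreement with [grad_dist_powR]. *)
Definition grad_weight (a : E) (x : borelE E) : R :=
  `|(x : E) - a| `^ (r - 1) / `|a - x|.

Lemma grad_weight_ge0 (a : E) x : 0 <= grad_weight a x.
Proof. by rewrite divr_ge0// powR_ge0. Qed.

Lemma grad_weight_gt0 (a : E) (x : E) : x != a -> 0 < grad_weight a x.
Proof.
move=> xa; have xa0 : 0 < `|x - a| by rewrite normr_gt0 subr_eq0.
by rewrite /grad_weight (distrC a) divr_gt0// powR_gt0.
Qed.

Lemma measurable_weight (a : E) : measurable_fun setT (grad_weight a).
Proof.
apply: measurable_funM; first exact: measurable_dist_powR.
rewrite (_ : (fun x => _) = (fun x : borelE E => `|(x : E) - a| `^ (-1))).
  exact: measurable_dist_powR.
by apply/funext => x; rewrite powR_inv1// distrC.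
Qed.

(** With s the distance and r >= 2, s^(r-2) is at most 1 for s <= 1 and at most s^r for s > 1. *)
Lemma grad_weight_le (a : E) x : grad_weight a x <= 1 + `|(x : E) - a| `^ r.
Proof.
rewrite /grad_weight (distrC a); set s := `|(x : E) - a|.
have [->|s0] := eqVneq s 0.
  by rewrite invr0 mulr0 addr_ge0// powR_ge0.
have s0' : 0 < s by rewrite lt0r s0 normr_ge0.
rewrite -(powR_inv1 (ltW s0')) -powRD ?s0 ?implybT//.
have [s1|s1] := leP s 1.
  have : s `^ (r - 1 + -1) <= 1 `^ (r - 1 + -1).
    by apply: ge0_ler_powR; rewrite ?nnegrE ?(ltW s0')//; move: r2; lra.
  by rewrite powR1; have := powR_ge0 s r; lra.
have : s `^ (r - 1 + -1) <= s `^ r by rewrite ler_powR ?(ltW s1)//; move: r2; lra.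
by lra.
Qed.

Lemma integrable_weight (a : E) (D : set (borelE E)) : measurable D ->
  P.-integrable D (EFin \o grad_weight a).
Proof.
move=> mD; have r0 : 0 < r by exact: lt_le_trans r2.
have ic : P.-integrable D (fun _ : borelE E => 1%:E).
  by apply: (@integrableS _ _ _ _ setT) => //; exact: finite_measure_integrable_cst.
have := integrableD mD ic (integrable_dist_powR r0 hmom a mD).
apply: le_integrable => //.
  by apply: measurable_funTS; apply/measurable_EFinP; exact: measurable_weight.
move=> x _ /=; rewrite lee_fin !ger0_norm ?addr_ge0 ?powR_ge0 ?grad_weight_ge0//.
exact: grad_weight_le.
Qed.

Lemma grad_dist_powRE (a u : E) x :
  grad_dist_powR ip r a u x = grad_weight a x * ip (a - x) u.
Proof. by rewrite /grad_dist_powR /grad_weight [RHS]mulrAC [LHS]mulrA. Qed.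

Variables (n : nat) (a : 'I_n -> E).
Hypothesis hmin : strict_local_min (distortion P r (n:=n)) a.

(** For an almost normal direction [u], the product <a_i - x, u> is at least -e|u| on [K] and at
    least (rho/2 - e)|u| on a ball of positive mass. For small [e] its weighted integral over the
    cell is positive, against stationarity. *)
Lemma strict_local_min_interior i : interior K !=set0 -> interior K (a i).
Proof.
move=> [c Kc]; apply: contrapT => nKa.
have r0 : 0 < r by exact: lt_le_trans r2.
have r1 : 1 <= r by move: r2; lra.
have Ka : K (a i) by exact: (strict_local_min_supp hip hrad r0 cvK hmin).
pose W : set (borelE E) := voronoiW a i.
have mW : measurable W by apply: open_borelE; exact: open_voronoiW.
have mK : measurable (K : set (borelE E)).
  by apply: closed_borelE; exact: closed_supp.
(* On the segment from a_i to [c], points other than a_i are interior to [K]; one near a_i also lies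
   in the open cell. *)
have [y [Ky Wy]] : exists y, interior K y /\ interior W y.
  have : nbhs (a i) (W : set E).
    by apply: open_nbhs_nbhs; split; [exact: open_voronoiW|exact: voronoiW_self].
  rewrite -nbhs_ballE => -[d /= d0 dW].
  have dc : 0 < d + `|c - a i| by rewrite ltr_pwDl.
  pose t := d / (d + `|c - a i|).
  have t0 : 0 < t by rewrite divr_gt0.
  have t1 : t <= 1 by rewrite ler_pdivrMr// mul1r lerDl.
  exists (a i + t *: (c - a i)); split.
    by apply: interior_segment => //; rewrite t0.
  suff : W (a i + t *: (c - a i)).
    by move: (@open_voronoiW _ _ _ a i); rewrite openE; apply.
  apply: dW; rewrite -ball_normE /= opprD addrA subrr add0r normrN.
  rewrite normrZ gtr0_norm//.
  by rewrite /t mulrAC ltr_pdivrMr// ltr_pM2l// ltrDr.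
have [rho rho0 rhoKW] : exists2 rho : R, 0 < rho & ball y rho `<=` K `&` W.
  have : nbhs y (K `&` W) by apply: filterI.
  by rewrite -nbhs_ballE => -[d /= d0 dKW]; exists d.
(* Half the radius leaves room to translate points of [B] by a vector of length rho/2 within [K]. *)
pose B : set (borelE E) := ball y (rho / 2).
have rho20 : 0 < rho / 2 by rewrite divr_gt0.
have BKW : B `<=` W `&` K.
  move=> x xB; rewrite setIC; apply: rhoKW; apply: le_ball xB.
  by lra.
have mB : measurable B by apply: open_borelE; exact: ball_open.
have mD : measurable (W `&` K) by exact: measurableI.
have naB x : B x -> x != a i.
  move=> Bx; apply/eqP => xa; apply: nKa; rewrite -xa.
  rewrite /interior nbhsE; exists B; last by move=> z /BKW[].
  by split => //; exact: ball_open.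
have m0 : 0 < \int[P]_(x in B) grad_weight (a i) x.
  rewrite lt0r; apply/andP; split; last first.
    by apply: Rintegral_ge0 => x _; exact: grad_weight_ge0.
  apply/eqP => mz.
  have : (0 < P B)%E.
    apply: (interior_subset Ky); first exact: ball_open.
    exact: ballxx.
  suff -> : P B = 0%E by rewrite ltxx.
  apply: (@positive_integral0_null _ _ _ P B (grad_weight (a i))) => //.
  - by apply: measurable_funTS; exact: measurable_weight.
  - by move=> x /naB; exact: grad_weight_gt0.
  - rewrite -[LHS]fineK; first by rewrite [fine _]mz.
    exact: (integrable_fin_num mB (integrable_weight (a i) mB)).
pose m := \int[P]_(x in B) grad_weight (a i) x.
pose M := \int[P]_(x in W `&` K) grad_weight (a i) x.
have M0 : 0 <= M by apply: Rintegral_ge0 => x _; exact: grad_weight_ge0.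
have [e [e0 eM]] : exists e, 0 < e /\ e * M < rho / 2 * m.
  (* [M + 1] is positive even if [M] is 0. *)
  exists (rho / 2 * m / (M + 1)); split; first by rewrite divr_gt0 ?mulr_gt0// ltr_wpDl.
  rewrite mulrAC ltr_pdivrMr ?ltr_wpDl// ltr_pM2l ?mulr_gt0//; lra.
(* No supporting functional at [a i] is needed: the normals at projections of
   points z outside K close to [a i] support K there up to the error e, and
   e times the finite mass M of the weight is absorbed by the mass on B. *)
have [z [za nKz]] : exists z, `|z - a i| < e /\ ~ K z.
  apply: contrapT => /forallNP h; apply: nKa; rewrite /interior -nbhs_ballE.
  exists e => // z; rewrite -ball_normE /= distrC => ze.
  by apply: contrapT => nKz; apply: (h z).
have [p Kp hp] :=
  hilbert_projection hip (supp_nonempty hrad) (@closed_supp _ _ P) cvK z.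
pose u := z - p.
have u0 : 0 < `|u|.
  by rewrite normr_gt0 subr_eq0; apply/eqP => zp; apply: nKz; rewrite zp.
have pa : `|a i - p| < e.
  by apply: le_lt_trans za; apply: (projection_dist_le hip); exact: hp.
have gK x : K x -> - (e * `|u|) <= ip (a i - x) u.
  move=> Kx; have -> : a i - x = (a i - p) - (x - p) by rewrite opprB addrA subrK.
  rewrite (ipBl hip) (ipC hip (x - p)).
  have := hp _ Kx; have := ip_norm_le hip (a i - p) u.
  rewrite ler_norml => /andP[h1 _] h2.
  have : `|a i - p| * `|u| <= e * `|u| by rewrite ler_pM2r// ltW.
  rewrite -/u in h2; lra.
have gB x : B x -> (rho / 2 - e) * `|u| <= ip (a i - x) u.
  (* Applying [gK] to x + v, still in [K], gains <v, u> = (rho/2)|u| over the bound at [x]. *)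
  move=> Bx; pose v := (rho / 2 / `|u|) *: u.
  have vu : `|v| = rho / 2.
    by rewrite /v normrZ gtr0_norm ?divr_gt0// divfK// gt_eqF.
  have Kxv : K (x + v).
    have [] // : (K `&` W) (x + v); apply: rhoKW.
    move: Bx; rewrite /B -!ball_normE /= opprD addrA => Bx.
    rewrite (le_lt_trans (ler_normB _ _))// vu; lra.
  have := gK _ Kxv; rewrite opprD addrA (ipBl hip (a i - x)).
  have -> : ip v u = rho / 2 * `|u|.
    rewrite (ipZl hip) (ipxx hip) expr2 mulrA divfK// gt_eqF//.
  lra.
(* Stationarity on the cell passes to its part in [K], the complement of [K] being null. *)
have iD : P.-integrable (W `&` K) (EFin \o grad_dist_powR ip r (a i) u) /\
    \int[P]_(x in W `&` K) grad_dist_powR ip r (a i) u x = 0.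
  have ai1 : r = 1 -> P [set a i] = 0%E.
    by move=> re; exfalso; move: r2; rewrite re; lra.
  have [iW W0] := grad_dist_powR_integral0 hip r1 hmom mW ai1
    (strict_local_min_cell_global r1 hmom hmin mW (fun _ => id)
       (@voronoiWV _ _ _ a i)) u.
  split; first by apply: integrableS iW => //; exact: subIsetl.
  rewrite /Rintegral; move: W0.
  have mWK : measurable (W `&` ~` K) by apply: measurableI => //; exact: measurableC.
  have WU : (W `&` K) `|` (W `&` ~` K) = W by rewrite -setIUr setUv setIT.
  rewrite -{1}WU integral_setU//.
  - rewrite [X in (_ + X)%E]null_set_integral ?adde0 => [->//|//||].
    + apply: measurable_funTS; apply/measurable_EFinP.
      exact: measurable_grad_dist_powR.
    + apply/eqP; rewrite -measure_le0 -(radon_supp_full hrad) le_measure ?inE//.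
      exact: measurableC.
  - apply: measurable_funTS; apply/measurable_EFinP.
    exact: measurable_grad_dist_powR.
  - by apply/disj_setPS => x [[_ Kx] [_ /(_ Kx)]].
case: iD => iD.
have mDB : measurable ((W `&` K) `\` B) by exact: measurableD.
have DU : B `|` ((W `&` K) `\` B) = W `&` K by rewrite setDUK.
have disjB : [disjoint B & (W `&` K) `\` B].
  by apply/disj_setPS => x [Bx [_ /(_ Bx)]].
rewrite -{1}DU Rintegral_setU ?DU// => h0.
have hB : (rho / 2 - e) * `|u| * m <= \int[P]_(x in B) grad_dist_powR ip r (a i) u x.
  rewrite /m -RintegralZl//; last exact: integrable_weight.
  apply: le_Rintegral => //.
  - exact: (integrableZl mB ((rho / 2 - e) * `|u|) (integrable_weight (a i) mB)).
  - by apply: integrableS iD.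
  - move=> x Bx; rewrite grad_dist_powRE mulrC ler_wpM2l ?grad_weight_ge0//.
    exact: gB.
have hD : - (e * `|u|) * \int[P]_(x in (W `&` K) `\` B) grad_weight (a i) x <=
    \int[P]_(x in (W `&` K) `\` B) grad_dist_powR ip r (a i) u x.
  rewrite -RintegralZl//; last exact: integrable_weight.
  apply: le_Rintegral => //.
  - exact: (integrableZl mDB (- (e * `|u|)) (integrable_weight (a i) mDB)).
  - by apply: integrableS iD => //; exact: subDsetl.
  - move=> x [[_ Kx] _]; rewrite grad_dist_powRE mulrC ler_wpM2l ?grad_weight_ge0//.
    exact: gK.
have MU : M = m + \int[P]_(x in (W `&` K) `\` B) grad_weight (a i) x.
  by rewrite /M -{1}DU Rintegral_setU ?DU//; exact: integrable_weight.
(* This positive number is the sum of the lower bounds [hB] and [hD], whereas the two integrals add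
   up to 0. *)
have : 0 < `|u| * (rho / 2 * m - e * M) by rewrite mulr_gt0// subr_gt0.
move: h0 hB hD MU; rewrite -/m; clearbody m M; move: `|u| => N.
move: (\int[P]_(x in _ `\` _) grad_weight _ _) => I.
move: (\int[P]_(x in _ `\` _) _) => J.
move: (\int[P]_(x in _) _) => L h0 hB hD ->.
nra.
Qed.

End interior_of_support.

Theorem theorem2p2 (R : realType) (E : completeNormedModType R)
  (ip : E -> E -> R) (hip : is_hilbert_inner ip)
  (P : probability (borelE E) R) (hradon : radon P)
  (r : R) (hr : 0 < r)
  (hmom : (\int[P]_x ((`|(x : E)| `^ r)%:E) < +oo)%E)
  (n : nat) (hn : (0 < n)%N)
  (hK : convex_set (supp P : set (convex_lmodType E)))
  (a : 'I_n -> E) (hmin : strict_local_min (distortion P r (n:=n)) a) :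
  (forall i, supp P (a i)) /\
  ((forall i, limit_point (supp P) (a i)) ->
     [/\ injective a,
         (1 <= r -> forall (i : 'I_n) (C : set (borelE E)), measurable C ->
            voronoiW a i `<=` C -> C `<=` voronoiV a i ->
            (0 < P C)%E /\
            forall y : E,
              (distortion (condP P C) r (fun _ : 'I_1 => a i)
               <= distortion (condP P C) r (fun _ : 'I_1 => y))%E) &
         (1 <= r -> (r = 1 -> forall i, P [set a i] = 0%E) ->
            stationary_quantizer ip P r a /\ admissible P a)]) /\
  (2 <= r -> (2 < r -> forall i, P [set a i] = 0%E) ->
     interior (supp P) !=set0 -> forall i, interior (supp P) (a i)).
Proof.
have cvK := convex_set_segment hK.
have Ka i : supp P (a i) by exact: (strict_local_min_supp hip hradon hr cvK hmin).
(* The open cell is a neighbourhood of a_i, a point of the support, hence has positive mass. *)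
have PC i (C : set (borelE E)) : measurable C -> voronoiW a i `<=` C -> (0 < P C)%E.
  move=> mC WC; have oW := @open_voronoiW R E n a i.
  apply: (lt_le_trans (Ka i _ oW (@voronoiW_self R E n a i))).
  by apply: le_measure => //; rewrite inE//; exact: open_borelE.
split; [exact: Ka|split; last first].
  by move=> r2 _ K0 i; exact: (strict_local_min_interior hip hradon r2 hmom cvK hmin).
move=> lim; have inja : injective a.
  (* A limit point has a point different from it nearby, which provides the nonzero vector asked for
     by [strict_local_min_inj]. *)
  have [y [ya _ _]] := lim (Ordinal hn) setT filterT.
  by apply: (strict_local_min_inj hr hmin (v := y - a (Ordinal hn))); rewrite ?subr_eq0.
split; first exact: inja.
  move=> r1 i C mC WC CV; split; first exact: PC WC.
  move=> y; rewrite !(distortion_condP P r1 _ mC); apply: lee_wpmul2l.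
    by rewrite lee_fin invr_ge0 fine_ge0.
  exact: (strict_local_min_cell_global r1 hmom hmin).
move=> r1 a1; split; last exact: (voronoi_admissible r1 hmom hmin hip).
split => //.
  move=> /a1 a0.
  have -> : range a = \bigcup_(i in [set: 'I_n]) [set a i].
    by apply/seteqP; split => [_ [i _ <-]|x [i _ ->]]; exists i.
  have mU : measurable (\bigcup_(i in [set: 'I_n]) [set a i] : set (borelE E)).
    apply: fin_bigcup_measurable => [|i _]; first exact: finite_finset.
    exact: set1_borelE.
  apply/negligibleP => //; rewrite -(bigsetU_fset_set _ finite_finset).
  elim/big_ind : _ => [|A B|i _].
  - exact: negligible_set0.
  - exact: negligibleU.
  - by exists [set a i]; split; [exact: set1_borelE|exact: a0|].
exists (first_voronoi_cell a); have part := voronoi_partition_first a hn.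
split=> // i; have [/(_ i) mC _ _ /(_ i) CV] := part.
have WC := voronoiW_sub_first (i := i) inja.
split=> [|u]; first exact: PC WC.
apply: (grad_dist_powR_integral0_setD1 hip r1 hmom mC) => [/a1//|].
exact: (strict_local_min_cell_global r1 hmom hmin).
Qed.
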